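(* Let $X$ be a uniformly convex and uniformly smooth Banach space and let $A:X\to 2^X$ be an m-accretive operator with $A^{-1}0\neq\emptyset$, and let $p\in A^{-1}0$. Suppose that there exists a weak modulus for the convergence condition $\Omega:\mathbb{N}\times\mathbb{N}^{\mathbb{N}}\to\mathbb{N}^{\mathbb{N}}$ for $A$. Let $\mathcal{S}=\{S(t)\mid t\geq 0\}$ be the semigroup generated by $A$ via the exponential formula. Then for any $x\in\mathrm{dom}A$ with $v\in Ax$, we have $$\forall k\in\mathbb{N}\ \forall s,s'\geq \chi(\Omega(K,\mathrm{id})(2k+1))\left(\|S(s)x-S(s')x\|\leq \frac{1}{k+1}\right),$$ where $$\chi(k)=\left\lceil\frac{1}{2}b^2+1\right\rceil(k+1)$$ for any $b,K\in\mathbb{N}$ with $b\geq\|x-Px\|$ and $K\geq\max\{\|v\|,\|x-p\|+\|p\|\}$.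
   Context: $\mathbb{N}=\{0,1,2,\dots\}$ and $\mathrm{id}:\mathbb{N}\to\mathbb{N}$ is the identity. $X$ is a real Banach space. Since $X$ is uniformly smooth, its normalized duality map $J(x)=\{f\in X^*\mid f(x)=\|x\|^2,\ \|f\|=\|x\|\}$ is single-valued; it is identified with a map $J:X\to X^*$ and $\langle y,J(x)\rangle$ denotes $J(x)(y)$. A set-valued operator $A:X\to 2^X$ is identified with its graph $\{(x,y)\mid y\in Ax\}$; $\mathrm{dom}A=\{x\mid Ax\neq\emptyset\}$ and $A^{-1}0=\{x\mid 0\in Ax\}$. $A$ is accretive if $\langle y_1-y_2,J(x_1-x_2)\rangle\geq 0$ for all $(x_1,y_1),(x_2,y_2)\in A$, and m-accretive if in addition $\mathrm{ran}(\mathrm{Id}+\gamma A)=X$ for all $\gamma>0$. If $A$ is m-accretive with $A^{-1}0\neq\emptyset$, then $A^{-1}0$ is closed and convex and $P$ denotes the (single-valued) nearest point projection of $X$ onto $A^{-1}0$. The semigroup generated by $A$ via the exponential formula is given by $S(t)x=\lim_{n\to\infty}(\mathrm{Id}+\frac{t}{n}A)^{-n}x$ for $x\in\overline{\mathrm{dom}A}$, $t\geq 0$ (the limit exists by the Crandall–Liggett theorem, and the $S(t)$ form a semigroup of nonexpansive maps on $\overline{\mathrm{dom}A}$, continuous in $t$). For a sequence $(a_n)$ of non-negative reals, $\varphi:\mathbb{N}\to\mathbb{N}$ is a rate of convergence (towards zero) if $\forall k\,\forall n\geq\varphi(k)\,(a_n\leq\frac{1}{k+1})$, and a rate of approximate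 zeros if $\forall k\,\exists n\leq\varphi(k)\,(a_n\leq\frac1{k+1})$. A weak modulus for the convergence condition for $A$ is a functional $\Omega:\mathbb{N}\times\mathbb{N}^{\mathbb{N}}\to\mathbb{N}^{\mathbb{N}}$ such that for any sequences $(x_n),(y_n)\subseteq X$, any $K\in\mathbb{N}$ and any $\varphi:\mathbb{N}\to\mathbb{N}$: if $y_n\in Ax_n$ and $\|x_n\|,\|y_n\|\leq K$ for all $n$, and $\varphi$ is a rate of convergence for $|\langle y_n,J(x_n-Px_n)\rangle|$, then $\Omega(K,\varphi)$ is a rate of approximate zeros for $\|x_n-Px_n\|$. *)

(* Defs.v *)
From HB Require Import structures.
From mathcomp Require Import all_boot all_order all_algebra.
From mathcomp Require Import all_classical all_reals all_analysis.

Set Implicit Arguments.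
Unset Strict Implicit.
Unset Printing Implicit Defensive.

Import Order.TTheory GRing.Theory Num.Theory.
Import numFieldNormedType.Exports.

Local Open Scope classical_set_scope.
Local Open Scope ring_scope.

Section geometry.
Context {R : realType}.

Definition uniformly_convex (X : normedModType R) : Prop :=
  forall e : R, 0 < e -> exists2 d : R, 0 < d &
    forall x y : X, `|x| <= 1 -> `|y| <= 1 -> e <= `|x - y| ->
      `|2^-1 *: (x + y)| <= 1 - d.

(* The unfolding of "the modulus of smoothness
   rho(t) = sup {(|x + y| + |x - y|) / 2 - 1 : |x| = 1, |y| = t}
   satisfies rho(t) / t -> 0 as t -> 0+". *)
Definition uniformly_smooth (X : normedModType R) : Prop :=
  forall e : R, 0 < e -> exists2 d : R, 0 < d &
    forall x y : X, `|x| = 1 -> `|y| <= d ->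
      `|x + y| + `|x - y| <= 2 + e * `|y|.

Context {X : normedModType R}.

(* Membership in the topological dual of X; R^o is R as a module over itself. *)
Definition continuous_functional (f : X -> R^o) : Prop :=
  linear f /\ continuous f.

Definition dual_norm (f : X -> R) : R :=
  sup [set `|f u| | u in [set u : X | `|u| <= 1]].

Definition duality_set (x : X) : set (X -> R) :=
  [set f | [/\ continuous_functional f, f x = `|x| ^+ 2 & dual_norm f = `|x|]].

(* duality_set x is a singleton when X is uniformly smooth; duality_map x is
   then its element. *)
Definition duality_map (x : X) : X -> R := xget (fun=> 0) (duality_set x).

(* If C is nonempty, closed and convex and X is a uniformly convex Banach
   space, then the nearest point exists and is unique. *)
Definition nearest_point (C : set X) (x : X) : X :=
  xget x [set p | C p /\ forall q, C q -> `|x - p| <= `|x - q|].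

End geometry.

Section operators.
Context {R : realType} {X : normedModType R}.
(* A x y stands for y \in A x *)
Implicit Types A : X -> set X.

Definition dom A : set X := [set x | A x !=set0].

Definition zeros A : set X := [set x | A x 0].

(* Stated with the single-valued duality map, hence meant for smooth X. *)
Definition accretive A : Prop := forall x1 y1 x2 y2,
  A x1 y1 -> A x2 y2 -> 0 <= duality_map (x1 - x2) (y1 - y2).

Definition m_accretive A : Prop := accretive A /\
  forall g : R, 0 < g -> forall z, exists x y, A x y /\ x + g *: y = z.

(* (Id + g A)^-1 z. The default z is only used when z is not in the range of
   Id + g A; for A m-accretive this requires g = 0 and z outside dom A, and
   makes the map the identity for g = 0. *)
Definition resolvent A (g : R) (z : X) : X :=
  xget z [set x | exists2 y, A x y & x + g *: y = z].

(* The exponential formula. In the term of index n = 0, t / 0 = 0 and the map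
   is iterated 0 times; this does not affect the limit. *)
Definition semigroup A (t : R) (x : X) : X :=
  lim ((fun n : nat => iter n (resolvent A (t / n%:R)) x) @ \oo).

Definition rate_of_convergence (a : nat -> R) (phi : nat -> nat) : Prop :=
  forall k n : nat, (phi k <= n)%N -> a n <= k.+1%:R^-1.

Definition rate_of_approximate_zeros (a : nat -> R) (phi : nat -> nat) : Prop :=
  forall k : nat, exists2 n : nat, (n <= phi k)%N & a n <= k.+1%:R^-1.

Definition weak_modulus A (Omega : nat -> (nat -> nat) -> (nat -> nat)) : Prop :=
  let P := nearest_point (zeros A) in
  forall (x y : nat -> X) (K : nat) (phi : nat -> nat),
    (forall n, [/\ A (x n) (y n), `|x n| <= K%:R & `|y n| <= K%:R]) ->
    rate_of_convergence
      (fun n => `|duality_map (x n - P (x n)) (y n)|) phi ->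
    rate_of_approximate_zeros (fun n => `|x n - P (x n)|) (Omega K phi).

End operators.

Definition chi (b k : nat) : nat :=
  (`|Num.ceil (2^-1 * b%:R ^+ 2 + 1 : rat)| * k.+1)%N.

(* Main.v *)
(* The semigroup is followed through the implicit Euler iterates
   u_i = (Id + h A)^-1 u_(i-1), u_0 = x, with slopes y_i = (u_(i-1) - u_i) / h in
   A u_i, instead of through the differential inclusion. Let d be the distance to
   the closed convex set of zeros, and P the nearest point projection onto it.
   Smoothness of the norm and convexity of d give, for small h,
     h <y_i, J (u_i - P u_i)> <= (d(u_(i-1))^2 - d(u_i)^2) / 2 + o(h),
   so after summation some i with i h <= chi n satisfies
   <y_i, J (u_i - P u_i)> <= 1 / (n + 1). These points, one for each n, form a
   sequence to which Omega applies with rate id, and yield an Euler iterate at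
   time at most chi (Omega K id (2 k + 1)) and at distance at most 1 / (2 k + 2)
   from a zero. Resolvents do not increase the distance to a zero, so all later
   iterates stay in that ball, and Kobayashi's estimate, which also proves the
   exponential formula, carries this over to the semigroup as the mesh goes to 0. *)
Require Import Defs.
From HB Require Import structures.
From mathcomp Require Import all_boot all_order all_algebra.
From mathcomp Require Import all_classical all_reals all_analysis.
From mathcomp Require Import ring lra.

Set Implicit Arguments.
Unset Strict Implicit.
Unset Printing Implicit Defensive.

Import Order.TTheory GRing.Theory Num.Theory.
Import numFieldNormedType.Exports.

Local Open Scope classical_set_scope.
Local Open Scope ring_scope.

(** * The duality map of a uniformly smooth space *)

Section duality.
Context {R : realType} {X : normedModType R}.
Implicit Types x y z w : X.

Lemma uniformly_smooth_scaled : uniformly_smooth X ->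
  forall e : R, 0 < e -> exists2 d : R, 0 < d &
    forall z w, `|w| <= d * `|z| -> `|z + w| + `|z - w| <= 2 * `|z| + e * `|w|.
Proof.
move=> smooth e e0; have [d d0 Hd] := smooth _ e0; exists d => // z w.
have [->|z0] := eqVneq z 0.
  by rewrite normr0 !mulr0 normr_le0 => /eqP->; rewrite subr0 addr0 normr0 mulr0 !addr0.
have nz : 0 < `|z| by rewrite normr_gt0.
have nzV : 0 <= `|z|^-1 by rewrite invr_ge0.
rewrite -ler_pdivrMr// => wd.
have E u : `| `|z|^-1 *: u| = `|u| / `|z| by rewrite normrZ ger0_norm// mulrC.
have := Hd (`|z|^-1 *: z) (`|z|^-1 *: w).
rewrite -scalerDr -scalerBr !E divff ?gt_eqF// => /(_ erefl wd).
by rewrite -mulrDl ler_pdivrMr// mulrDl -mulrA divfK ?gt_eqF.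
Qed.

Definition diff_quotient x y (t : R) : R := (`|x + t *: y| - `|x|) / t.

(* The difference quotient increases with t, so the infimum is the one-sided
   derivative. For a smooth norm it is linear in y, hence a norming functional
   of x: this replaces the Hahn-Banach theorem. *)
Definition norm_derivative x y : R :=
  inf [set diff_quotient x y t | t in [set t | 0 < t]].

Lemma diff_quotient_ge x y (t : R) : 0 < t -> - `|y| <= diff_quotient x y t.
Proof.
move=> t0; rewrite ler_pdivlMr// mulNr lerBrDr addrC lerBlDr.
have := ler_normB (x + t *: y) (t *: y).
by rewrite addrK normrZ gtr0_norm// mulrC.
Qed.

Lemma norm_derivative_le x y (t : R) :
  0 < t -> norm_derivative x y <= diff_quotient x y t.
Proof.
move=> t0; apply: ge_inf; last by exists t.
by exists (- `|y|) => _ [s s0 <-]; exact: diff_quotient_ge.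
Qed.

Lemma norm_derivative_ge x y (a : R) :
  (forall t : R, 0 < t -> a <= diff_quotient x y t) -> a <= norm_derivative x y.
Proof.
move=> H; apply: lb_le_inf; first by exists (diff_quotient x y 1), 1 => //=.
by move=> _ [s s0 <-]; exact: H.
Qed.

(** For [r = t s / (t + s)], the point [x + r (y + z)] is a convex combination of [x + t y] and
    [x + s z], so the quotient at [r] is at most the sum of those at [t] and [s]. *)
Lemma norm_derivativeD x y z :
  norm_derivative x (y + z) <= norm_derivative x y + norm_derivative x z.
Proof.
rewrite -lerBlDr; apply: norm_derivative_ge => t t0.
rewrite lerBlDr -lerBlDl; apply: norm_derivative_ge => s s0.
rewrite lerBlDl; have ts0 : 0 < t + s by rewrite addr_gt0.
have r0 : 0 < t * s / (t + s) by rewrite divr_gt0// mulr_gt0.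
apply: le_trans (norm_derivative_le _ _ r0) _.
rewrite ler_pdivrMr// /diff_quotient.
have -> : x + (t * s / (t + s)) *: (y + z) =
    (s / (t + s)) *: (x + t *: y) + (t / (t + s)) *: (x + s *: z).
  rewrite !scalerDr !scalerA addrACA -scalerDl -mulrDl (addrC s t).
  by rewrite divff ?gt_eqF// scale1r; congr (_ + (_ *: _ + _ *: _)); field; lra.
apply: le_trans (lerB (ler_normD _ _) (lexx _)) _.
have sn : 0 <= s / (t + s) by rewrite divr_ge0// ltW.
have tn : 0 <= t / (t + s) by rewrite divr_ge0// ltW.
rewrite (normrZ (s / _)) (normrZ (t / _)) (ger0_norm sn) (ger0_norm tn).
rewrite le_eqVlt; apply/orP; left; apply/eqP.
by field; rewrite !gt_eqF.
Qed.

Lemma norm_derivativeZ x y (c : R) : 0 < c ->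
  norm_derivative x (c *: y) = c * norm_derivative x y.
Proof.
have half (k : R) w : 0 < k -> k * norm_derivative x w <= norm_derivative x (k *: w).
  move=> k0; apply: norm_derivative_ge => t t0; rewrite -ler_pdivlMl//.
  apply: le_trans (norm_derivative_le _ _ (mulr_gt0 t0 k0)) _.
  rewrite /diff_quotient scalerA le_eqVlt; apply/orP; left; apply/eqP.
  by field; rewrite !gt_eqF.
move=> c0; apply/eqP; rewrite eq_le half// andbT -ler_pdivrMl//.
have := half _ (c *: y) (ltac:(by rewrite invr_gt0) : 0 < c^-1).
by rewrite scalerA mulVf ?gt_eqF// scale1r.
Qed.

Lemma norm_derivative_self x : norm_derivative x x = `|x|.
Proof.
have E t : 0 < t -> diff_quotient x x t = `|x|.
  move=> t0; rewrite /diff_quotient -{1}(scale1r x) -scalerDl normrZ gtr0_norm; last lra.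
  by field; rewrite gt_eqF.
apply/eqP; rewrite eq_le; apply/andP; split.
  by rewrite -(E 1)// norm_derivative_le.
by apply: norm_derivative_ge => t /E->.
Qed.

Lemma norm_derivative_norm x y : norm_derivative x y <= `|y|.
Proof.
apply: le_trans (norm_derivative_le _ _ ltr01) _.
by rewrite /diff_quotient divr1 scale1r lerBlDl ler_normD.
Qed.

Lemma norm_derivative0 x : norm_derivative x 0 = 0.
Proof.
have E t : diff_quotient x 0 t = 0.
  by rewrite /diff_quotient scaler0 addr0 subrr mul0r.
apply/eqP; rewrite eq_le; apply/andP; split.
  by rewrite -(E 1) norm_derivative_le.
by apply: norm_derivative_ge => t _; rewrite E.
Qed.

(** Smoothness yields linearity here: the quotients in directions [y] and [- y] add up to
    [(|x + t y| + |x - t y| - 2 |x|) / t], which is at most any given [e] for a suitable [t]. *)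
Lemma norm_derivativeN x y : uniformly_smooth X -> x != 0 ->
  norm_derivative x (- y) = - norm_derivative x y.
Proof.
move=> smooth x0; apply/eqP; rewrite eq_le; apply/andP; split; last first.
  by rewrite -[leLHS]add0r lerBlDr -(norm_derivative0 x) -(addNr y) norm_derivativeD.
rewrite -subr_le0 opprK; have nx : 0 < `|x| by rewrite normr_gt0.
have y1 : 0 < `|y| + 1 by rewrite ltr_wpDl.
apply/ler_addgt0Pr => e e0; rewrite add0r.
have [d d0 Hd] := uniformly_smooth_scaled smooth (divr_gt0 e0 y1).
(* This choice gives [|t y| <= d |x|]; the [+ 1] covers [y = 0]. *)
pose t := d * `|x| / (`|y| + 1).
have t0 : 0 < t by rewrite /t !(divr_gt0, mulr_gt0).
have ty : `|t *: y| = t * `|y| by rewrite normrZ gtr0_norm.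
have H : `|x + t *: y| + `|x - t *: y| <= 2 * `|x| + e / (`|y| + 1) * `|t *: y|.
  apply: Hd; rewrite ty.
  rewrite /t mulrAC ler_pdivrMr// ler_wpM2l ?lerDl//.
  by rewrite mulr_ge0// ltW.
have := lerD (norm_derivative_le x (- y) t0) (norm_derivative_le x y t0).
move/le_trans; apply.
rewrite ty in H; rewrite /diff_quotient -mulrDl ler_pdivrMr// scalerN.
have : e / (`|y| + 1) * (t * `|y|) <= e * t.
  rewrite [leLHS](_ : _ = (e * t) * (`|y| / (`|y| + 1))); last by ring.
  by rewrite ler_piMr ?mulr_ge0 ?ltW// ltr_pdivrMr// mul1r ltrDl.
lra.
Qed.

Lemma norm_derivative_linear x : uniformly_smooth X -> x != 0 ->
  linear (norm_derivative x : X -> R^o).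
Proof.
move=> smooth x0.
have add y z : norm_derivative x (y + z) = norm_derivative x y + norm_derivative x z.
  apply/eqP; rewrite eq_le norm_derivativeD /=.
  rewrite -[leRHS]opprK -norm_derivativeN// opprD lerNr opprD.
  by rewrite -!norm_derivativeN// norm_derivativeD.
move=> c y z; rewrite add; congr (_ + _).
have [c0|c0|<-] := ltgtP 0 c; last by rewrite !scale0r norm_derivative0.
  by rewrite norm_derivativeZ.
rewrite -[c]opprK scaleNr norm_derivativeN// norm_derivativeZ ?oppr_gt0//.
by rewrite scaleNr.
Qed.

Lemma dual_norm_bound (f : X -> R) u :
  continuous_functional f -> `|f u| <= dual_norm f * `|u|.
Proof.
move=> [f_lin f_cont].
pose F : {linear X -> R^o} :=
  HB.pack (f : X -> R^o) (GRing.isLinear.Build R X R^o *:%R f f_lin).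
have : bounded_near F (nbhs (0 : X)).
  by apply: continuous_linear_bounded; exact: f_cont.
move=> /linear_boundedP[M [_ HM]].
(* A supremum bounds its members only if the set is bounded, which continuity provides. *)
have ub : has_ubound [set `|f w| | w in [set w : X | `|w| <= 1]].
  exists (`|M| + 1) => _ [w w1 <-].
  have : `|f w| <= (`|M| + 1) * `|w|.
    by apply: HM; rewrite (le_lt_trans (ler_norm M))// ltrDl.
  by move/le_trans; apply; rewrite ler_piMr// addr_ge0.
have [->|u0] := eqVneq u 0.
  by rewrite (linear0 F : f 0 = 0) !normr0 mulr0.
have nu : 0 < `|u| by rewrite normr_gt0.
rewrite -ler_pdivrMr//.
have -> : `|f u| / `|u| = `|f (`|u|^-1 *: u)|.
  have -> : f (`|u|^-1 *: u) = `|u|^-1 * f u by exact: (linearZZ F).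
  by rewrite normrM ger0_norm ?invr_ge0// mulrC.
apply: ub_le_sup => //; exists (`|u|^-1 *: u) => //=.
by rewrite normrZ ger0_norm ?invr_ge0// mulVf ?gt_eqF.
Qed.

(** For [x != 0], take [|x|] times the directional derivative of the norm at [x]; its dual norm is
    attained at [x / |x|]. Thus the choice in [duality_map] is a genuine member. *)
Lemma duality_setN0 x : uniformly_smooth X -> duality_set x !=set0.
Proof.
move=> smooth.
have [->|x0] := eqVneq x 0.
  exists (fun=> 0); split; last 2 first.
  - by rewrite normr0 expr0n.
  - rewrite normr0 /dual_norm [X in sup X](_ : _ = [set 0]) ?sup1//.
    apply/seteqP; split => [_ [u _ <-]|_ ->] /=; first by rewrite normr0.
    by exists 0; rewrite /= normr0.
  - by split; [move=> c u w; rewrite scaler0 addr0|exact: cst_continuous].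
have nx : 0 < `|x| by rewrite normr_gt0.
have lin : linear (fun u => `|x| * norm_derivative x u : R^o).
  move=> c u w; rewrite norm_derivative_linear// mulrDr; congr (_ + _).
  by rewrite /GRing.scale /= mulrCA.
pose F : {linear X -> R^o} := HB.pack (fun u => `|x| * norm_derivative x u : R^o)
  (GRing.isLinear.Build R X R^o *:%R _ lin).
have bnd u : `|F u| <= `|x| * `|u|.
  rewrite normrM normr_id ler_wpM2l// ler_norml norm_derivative_norm andbT.
  by rewrite lerNl -norm_derivativeN// (le_trans (norm_derivative_norm _ _))// normrN.
exists F; split.
- split; first exact: lin.
  apply: bounded_linear_continuous; apply/linear_boundedP.
  exists `|x|; split; first exact: normr_real.
  by move=> M xM u; apply: le_trans (bnd u) _; rewrite ler_wpM2r// ltW.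
- by rewrite /= norm_derivative_self expr2.
- apply/eqP; rewrite eq_le; apply/andP; split.
    apply: ge_sup; first by exists `|F 0|, 0; rewrite /= ?normr0.
    by move=> _ [u u1 <-]; apply: le_trans (bnd u) _; rewrite ler_piMr.
  apply: ub_le_sup.
    by exists `|x| => _ [u u1 <-]; apply: le_trans (bnd u) _; rewrite ler_piMr.
  exists (`|x|^-1 *: x) => /=.
    by rewrite normrZ ger0_norm ?invr_ge0// mulVf ?gt_eqF.
  rewrite norm_derivativeZ ?invr_gt0// norm_derivative_self mulVf ?gt_eqF//.
  by rewrite mulr1 normr_id.
Qed.

Lemma duality_mapP x : uniformly_smooth X -> duality_set x (duality_map x).
Proof. by move=> smooth; apply: xgetPex; exact: duality_setN0. Qed.

Lemma duality_map_self x : uniformly_smooth X -> duality_map x x = `|x| ^+ 2.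
Proof. by move=> smooth; case: (duality_mapP x smooth). Qed.

Lemma duality_map_linear x : uniformly_smooth X ->
  linear (duality_map x : X -> R^o).
Proof. by move=> smooth; case: (duality_mapP x smooth) => -[]. Qed.

Lemma duality_map_bound x u : uniformly_smooth X ->
  `|duality_map x u| <= `|x| * `|u|.
Proof.
by move=> smooth; case: (duality_mapP x smooth) => + _ <-; exact: dual_norm_bound.
Qed.

End duality.

(** * Uniform convexity and nearest points *)

Section convexity.
Context {R : realType}.

Lemma cauchy_seq_is_cvg (X : completeNormedModType R) (u : nat -> X) :
  (forall e : R, 0 < e ->
    exists N, forall m n, (N <= m)%N -> (N <= n)%N -> `|u m - u n| <= e) ->
  cvg (u @ \oo).
Proof.
move=> H; apply/cauchy_cvgP/cauchy_exP => e e0.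
have [N HN] := H _ (ltac:(by rewrite divr_gt0) : 0 < e / 2).
exists (u N); suff : \forall n \near \oo, ball (u N) e (u n) by [].
near=> n; rewrite -ball_normE /=.
apply: (@le_lt_trans _ _ (e / 2)); last lra.
by apply: HN => //; near: n; exact: nbhs_infty_ge.
Unshelve. all: by end_near. Qed.

Lemma uniformly_convex_scaled (X : normedModType R) : uniformly_convex X ->
  forall e : R, 0 < e -> exists2 d : R, 0 < d &
    forall (r : R) (x y : X), 0 < r -> `|x| <= r -> `|y| <= r ->
      e * r <= `|x - y| -> `|2^-1 *: (x + y)| <= (1 - d) * r.
Proof.
move=> convex e e0; have [d d0 Hd] := convex _ e0; exists d => // r x y r0.
have E u : `|r^-1 *: u| = `|u| / r by rewrite normrZ gtr0_norm ?invr_gt0// mulrC.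
move=> xr yr xy; have := Hd (r^-1 *: x) (r^-1 *: y).
rewrite -scalerDr -scalerBr scalerA mulrC -scalerA !E.
by rewrite !ler_pdivrMr// !ler_pdivlMr// !mul1r; exact.
Qed.

(** Otherwise uniform convexity with [e = |x - y| / r] puts the midpoint strictly inside the ball of
    radius [r]. *)
Lemma uniformly_convex_strict (X : normedModType R) (r : R) (x y : X) :
  uniformly_convex X -> `|x| <= r -> `|y| <= r -> r <= `|2^-1 *: (x + y)| ->
  x = y.
Proof.
move=> convex xr yr xyr.
have [r0|r0] := leP r 0.
  have Z (u : X) : `|u| <= r -> u = 0.
    by move=> /le_trans/(_ r0); rewrite normr_le0 => /eqP.
  by rewrite (Z x xr) (Z y yr).
apply/eqP; apply: contraT => xy.
have e0 : 0 < `|x - y| / r by rewrite divr_gt0// normr_gt0 subr_eq0.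
have [d d0 Hd] := uniformly_convex_scaled convex e0.
have := Hd r x y r0 xr yr; rewrite divfK ?gt_eqF// lexx => /(_ isT) H.
have : 0 < d * r by rewrite mulr_gt0.
lra.
Qed.

Lemma harmonic_eventually_le (e : R) : 0 < e ->
  exists N, forall n, (N <= n)%N -> n.+1%:R^-1 <= e.
Proof.
move=> e0; exists (Num.trunc e^-1) => n Nn.
rewrite invf_ple ?posrE//; apply: le_trans (ltW (truncnS_gt _)) _.
by rewrite ler_nat.
Qed.

Lemma half_double (X : normedModType R) (x : X) : 2^-1 *: (x + x) = x.
Proof. by rewrite -mulr2n -(scaler_nat 2 x) scalerA mulVf ?scale1r. Qed.

Lemma nearest_point_exists (X : completeNormedModType R) (C : set X) (x : X) :
  uniformly_convex X -> C !=set0 -> closed C ->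
  (forall p q, C p -> C q -> C (2^-1 *: (p + q))) ->
  exists p, C p /\ forall q, C q -> `|x - p| <= `|x - q|.
Proof.
move=> convex [q0 Cq0] Cclosed Cmid.
pose D := [set `|x - q| | q in C].
have D0 : has_inf D by split; [exists `|x - q0|, q0|exists 0 => _ [q _ <-]].
have D_lb q : C q -> inf D <= `|x - q|.
  by move=> Cq; apply: ge_inf; [case: D0|exists q].
have D_ge0 : 0 <= inf D.
  by apply: lb_le_inf; [case: D0|move=> _ [q _ <-]].
(* Near-minimisers are close together: otherwise their midpoint, again in [C], would beat the
   infimum. Hence minimising sequences are Cauchy. *)
have cluster (e : R) : 0 < e -> exists2 d : R, 0 < d & forall q q', C q -> C q' ->
    `|x - q| <= inf D + d -> `|x - q'| <= inf D + d -> `|q - q'| <= e.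
  move=> e0; have [D_le0|D_gt0] := leP (inf D) 0.
    exists (e / 2); first lra.
    move=> q q' _ _ xq xq'; have := ler_distD x q q'; rewrite (distrC q x); lra.
  have e'0 : 0 < e / (inf D + 1) by rewrite divr_gt0// addr_gt0.
  have [d d0 Hd] := uniformly_convex_scaled convex e'0.
  (* The first bound gives [e / (inf D + 1) * (inf D + m) <= e], the second
     [(1 - d) * (inf D + m) < inf D]. *)
  pose m := Num.min 1 (d * inf D / 2).
  have m1 : m <= 1 by rewrite ge_min lexx.
  have m2 : m <= d * inf D / 2 by rewrite ge_min lexx orbT.
  have dD : 0 < d * inf D by rewrite mulr_gt0.
  have m0 : 0 < m by rewrite lt_min ltr01; lra.
  exists m => // q q' Cq Cq' xq xq'; rewrite leNgt; apply/negP => qq'.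
  have e'le : e / (inf D + 1) * (inf D + m) <= `|x - q - (x - q')|.
    rewrite [x - q - _](_ : _ = - (q - q')); last by rewrite opprB addrC subrKA opprB.
    rewrite normrN (le_trans _ (ltW qq'))// mulrAC ler_pdivrMr ?addr_gt0//.
    by apply: ler_wpM2l; [exact: ltW|rewrite lerD2l].
  have := Hd (inf D + m) (x - q) (x - q') (addr_gt0 D_gt0 m0) xq xq' e'le.
  have := D_lb _ (Cmid _ _ Cq Cq').
  rewrite [x - 2^-1 *: _](_ : _ = 2^-1 *: (x - q + (x - q'))); last first.
    by rewrite addrACA -opprD [RHS]scalerBr half_double.
  have : 0 <= d * m by rewrite mulr_ge0// ltW.
  lra.
have /choice[u uP] (n : nat) : exists q, C q /\ `|x - q| <= inf D + n.+1%:R^-1.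
  have n0 : 0 < n.+1%:R^-1 :> R by rewrite invr_gt0.
  have [_ [q Cq <-] /ltW Hq] := inf_adherent n0 D0.
  by exists q.
have u_cvg : cvg (u @ \oo).
  apply: cauchy_seq_is_cvg => e /cluster[d /harmonic_eventually_le[N HN] Hd].
  exists N => m n Nm Nn; case: (uP m) (uP n) => Cm um [Cn un].
  apply: Hd => //; [apply: le_trans um _|apply: le_trans un _].
    by rewrite lerD2l HN.
  by rewrite lerD2l HN.
exists (lim (u @ \oo)); split.
  apply: (closed_cvg _ Cclosed _ _ u_cvg); near=> n; by case: (uP n).
move=> q Cq; apply: le_trans (D_lb _ Cq); apply/ler_addgt0Pr => e e0.
have e2 : 0 < e / 2 by rewrite divr_gt0.
have [N HN] := harmonic_eventually_le e2.
have [M _ HM] := (cvgrPdist_le _ _).1 u_cvg _ e2.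
have [_ uN] := uP (maxn N M); have := HN _ (leq_maxl N M).
have := HM (maxn N M) (leq_maxr N M).
have := ler_distD (u (maxn N M)) x (lim (u @ \oo)).
rewrite (distrC (u _) (lim _)). move=> a1 a2 a3.
apply: le_trans a1 _; rewrite (le_trans (lerD uN a2))// -addrA lerD2l.
by rewrite [leRHS]splitr lerD2r.
Unshelve. all: by end_near. Qed.

End convexity.

(** * Resolvents and the set of zeros *)

Section resolvent.
Context {R : realType} {X : normedModType R}.
Implicit Types (A : X -> set X) (g : R) (x y z : X).

(** Pair the right-hand vector with [J (x1 - x2)]: the value is at least [|x1 - x2|^2] by
    accretivity and at most [|x1 - x2|] times the length of the vector. *)
Lemma accretive_expansive A x1 y1 x2 y2 g : uniformly_smooth X -> accretive A ->
  A x1 y1 -> A x2 y2 -> 0 <= g ->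
  `|x1 - x2| <= `|x1 - x2 + g *: (y1 - y2)|.
Proof.
move=> smooth accr A1 A2 g0; have := accr _ _ _ _ A1 A2.
set j := duality_map (x1 - x2) => j0.
have jE : j (g *: (y1 - y2) + (x1 - x2)) = g * j (y1 - y2) + `|x1 - x2| ^+ 2.
  by rewrite -duality_map_self//; exact: duality_map_linear.
have := le_trans (ler_norm _)
  (duality_map_bound (x1 - x2) (g *: (y1 - y2) + (x1 - x2)) smooth).
rewrite -/j jE [g *: _ + _]addrC => H.
have [->|n0] := eqVneq (x1 - x2) 0; first by rewrite normr0.
have nz : 0 < `|x1 - x2| by rewrite normr_gt0.
rewrite -(ler_pM2l nz) -expr2; apply: le_trans H.
by rewrite lerDr mulr_ge0.
Qed.

Context (A : X -> set X) (X_smooth : uniformly_smooth X) (A_maccr : m_accretive A).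

Lemma resolventP g z : 0 < g ->
  A (resolvent A g z) (g^-1 *: (z - resolvent A g z)).
Proof.
move=> g0; have [x [y [Axy <-]]] := A_maccr.2 _ g0 z.
have /xgetPex : exists u, [set u | exists2 w, A u w & u + g *: w = x + g *: y] u.
  by exists x, y.
move=> /(_ (x + g *: y)); rewrite -/(resolvent A g (x + g *: y)).
move: (resolvent _ _ _) => u [w Aw <-].
by rewrite (addrC u) addrK scalerA mulVf ?gt_eqF// scale1r.
Qed.

(** Here [x] is the resolvent of [x + g *: y]. Special cases are nonexpansiveness, the approach to
    zeros ([y = 0]) and the bound on the first Euler step ([z = x]). *)
Lemma resolvent_dist g x y z : 0 < g -> A x y ->
  `|resolvent A g z - x| <= `|z - (x + g *: y)|.
Proof.
move=> g0 Axy.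
have := accretive_expansive X_smooth A_maccr.1 (resolventP z g0) Axy (ltW g0).
rewrite scalerBr scalerA divff ?gt_eqF// scale1r.
by rewrite [X in _ <= `|X|](_ : _ = z - (x + g *: y))// opprD addrACA subrKC addrA.
Qed.

Lemma resolvent_nonexpansive g z z' : 0 < g ->
  `|resolvent A g z - resolvent A g z'| <= `|z - z'|.
Proof.
move=> g0; apply: le_trans (resolvent_dist z g0 (resolventP z' g0)) _.
by rewrite scalerA divff ?gt_eqF// scale1r subrKC.
Qed.

Lemma resolvent_dist_zero g q z : 0 < g -> zeros A q ->
  `|resolvent A g z - q| <= `|z - q|.
Proof. by move=> g0 /(resolvent_dist z g0); rewrite scaler0 addr0. Qed.

Lemma zerosE g q : 0 < g -> zeros A q <-> resolvent A g q = q.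
Proof.
move=> g0; split => [/(resolvent_dist_zero q g0)|qE].
  by rewrite subrr normr0 normr_le0 subr_eq0 => /eqP.
by have := resolventP q g0; rewrite qE subrr scaler0.
Qed.

(** Zeros are the fixed points of [resolvent A 1], which moves a point by at most twice its distance
    to any zero. *)
Lemma closed_zeros : closed (zeros A).
Proof.
move=> q qcl; apply/(zerosE _ ltr01)/eqP; rewrite -subr_eq0.
rewrite -(normr_le0 (_ - _)); apply/ler_addgt0Pr => e e0; rewrite add0r.
have /qcl [q' [/= Aq']] : nbhs q (ball q (e / 2)) by apply: nbhsx_ballx; rewrite divr_gt0.
rewrite -ball_normE /= => qq'.
have := resolvent_dist_zero q ltr01 Aq'.
have := ler_distD q' (resolvent A 1 q) q; rewrite (distrC q'); lra.
Qed.

(** The resolvent [z] of the midpoint lies within [|q - q'| / 2] of both ends, so strict convexity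
    forces [z] to be the midpoint. *)
Lemma zeros_midpoint q q' : uniformly_convex X ->
  zeros A q -> zeros A q' -> zeros A (2^-1 *: (q + q')).
Proof.
move=> convex Aq Aq'; apply/(zerosE _ ltr01).
set m := 2^-1 *: _; set z := resolvent A 1 m.
have mq : m - q = 2^-1 *: (q' - q).
  by rewrite /m -{2}(half_double q) -scalerBr opprD addrACA subrr add0r.
have mq' : m - q' = 2^-1 *: (q - q').
  by rewrite /m -{2}(half_double q') -scalerBr opprD addrACA subrr addr0.
have : z - q = q' - z.
  apply: (@uniformly_convex_strict R X `|2^-1 *: (q' - q)|) => //.
  - by rewrite -mq; exact: resolvent_dist_zero.
  - rewrite distrC (le_trans (resolvent_dist_zero _ ltr01 Aq'))// mq'.
    by rewrite -opprB scalerN normrN.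
  - by rewrite (addrC (z - q)) subrKA.
move=> /eqP; rewrite subr_eq addrAC eq_sym subr_eq => /eqP E.
by rewrite /m (addrC q) E half_double.
Qed.

End resolvent.

(** * Implicit Euler iterates and their comparison on two meshes *)

Section implicit_euler.
Context {R : realType} {X : normedModType R}.
Context (A : X -> set X) (X_smooth : uniformly_smooth X) (A_maccr : m_accretive A).

Definition euler (h : R) (n : nat) (x : X) : X := iter n (resolvent A h) x.

Definition euler_slope (h : R) (n : nat) (x : X) : X :=
  h^-1 *: (euler h n x - euler h n.+1 x).

Lemma euler_slopeP h n x : 0 < h -> A (euler h n.+1 x) (euler_slope h n x).
Proof. exact: resolventP. Qed.

Lemma euler_step h n x v : 0 < h -> A x v ->
  `|euler h n x - euler h n.+1 x| <= h * `|v|.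
Proof.
move=> h0 Axv; elim: n => [|n IHn].
  rewrite distrC; apply: le_trans (resolvent_dist X_smooth A_maccr x h0 Axv) _.
  by rewrite opprD addrA subrr add0r normrN normrZ gtr0_norm.
exact: le_trans (resolvent_nonexpansive X_smooth A_maccr _ _ h0) IHn.
Qed.

Lemma euler_slope_norm h n x v : 0 < h -> A x v -> `|euler_slope h n x| <= `|v|.
Proof.
move=> h0 Axv; rewrite normrZ gtr0_norm ?invr_gt0// ler_pdivrMl//.
exact: euler_step.
Qed.

Lemma euler_dist h n x v : 0 < h -> A x v ->
  `|x - euler h n x| <= n%:R * h * `|v|.
Proof.
move=> h0 Axv; elim: n => [|n IHn]; first by rewrite subrr normr0 !mul0r.
apply: le_trans (ler_distD (euler h n x) _ _) _.
by rewrite -natr1 !mulrDl mul1r lerD// euler_step.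
Qed.

Lemma euler_dist_zero h i j x q : 0 < h -> zeros A q -> (i <= j)%N ->
  `|euler h j x - q| <= `|euler h i x - q|.
Proof.
move=> h0 Aq /subnK<-; elim: (j - i)%N => [//|n IHn].
exact: le_trans (resolvent_dist_zero X_smooth A_maccr _ h0 Aq) IHn.
Qed.

Lemma resolvent_two_steps (l m : R) z w : 0 < l -> 0 < m ->
  `|resolvent A m z - resolvent A l w| <=
    l / (l + m) * `|z - resolvent A l w| + m / (l + m) * `|resolvent A m z - w|.
Proof.
move=> l0 m0; have lm0 : 0 < l + m by rewrite addr_gt0.
have Az := resolventP A_maccr z m0; have Aw := resolventP A_maccr w l0.
move: (resolvent A m z) (resolvent A l w) Az Aw => x1 x2 Az Aw.
(* With this parameter the expanded vector is a convex combination of [z - x2] and [x1 - w]. *)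
have r0 : 0 <= l * m / (l + m) by rewrite divr_ge0 ?mulr_ge0 ?ltW.
apply: le_trans (accretive_expansive X_smooth A_maccr.1 Az Aw r0) _.
have -> : x1 - x2 + (l * m / (l + m)) *: (m^-1 *: (z - x1) - l^-1 *: (w - x2)) =
    (l / (l + m)) *: (z - x2) + (m / (l + m)) *: (x1 - w).
  rewrite scalerBr !scalerA.
  have -> : l * m / (l + m) / m = l / (l + m) by field; rewrite !gt_eqF.
  have -> : l * m / (l + m) / l = m / (l + m) by field; rewrite !gt_eqF.
  have -> : x1 - x2 = (l / (l + m)) *: (x1 - x2) + (m / (l + m)) *: (x1 - x2).
    by rewrite -scalerDl -mulrDl divff ?scale1r ?gt_eqF.
  rewrite -scalerN addrACA -!scalerDr; congr (_ *: _ + _ *: _).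
    by rewrite addrC subrKA.
  by rewrite opprB addrA subrK.
apply: le_trans (ler_normD _ _) _.
have a0 : 0 <= l / (l + m) by rewrite divr_ge0 ?ltW.
have b0 : 0 <= m / (l + m) by rewrite divr_ge0 ?ltW.
by rewrite (normrZ (l / _)) (normrZ (m / _)) (ger0_norm a0) (ger0_norm b0).
Qed.

(* Kobayashi's estimate: the bracket c(m, n) satisfies exactly the recursion
   c(m+1, n+1) = k/(h+k) c(m, n+1) + h/(h+k) c(m+1, n)
   that resolvent_two_steps and the convexity of the square impose on the
   left-hand side as an inequality. *)
Lemma euler_two_meshes (h k : R) m n x v : 0 < h -> 0 < k -> A x v ->
  `|euler h m x - euler k n x| ^+ 2 <= `|v| ^+ 2 *
    ((m%:R * h - n%:R * k) ^+ 2 + m%:R * h ^+ 2 + n%:R * k ^+ 2).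
Proof.
move=> h0 k0 Axv.
have sq (a b : R) : 0 <= a -> a <= b -> a ^+ 2 <= b ^+ 2.
  by move=> a0 ab; rewrite lerXn2r// nnegrE// (le_trans a0 ab).
have v0 : 0 <= `|v| ^+ 2 by rewrite exprn_ge0.
(* When one index is 0, the square of the bound in [euler_dist] is the leading term of the
   bracket. *)
elim: m n => [|m IHm] n.
  apply: le_trans (sq _ _ _ (euler_dist n k0 Axv)) _ => //.
  rewrite exprMn mulrC ler_wpM2l// !mul0r sub0r sqrrN addr0 lerDl.
  by rewrite mulr_ge0// exprn_ge0// ltW.
elim: n => [|n IHn].
  apply: le_trans (sq _ _ _ (_ : _ <= m.+1%:R * h * `|v|)) _ => //.
    by rewrite distrC; exact: euler_dist.
  rewrite exprMn mulrC ler_wpM2l// !mul0r subr0 addr0 lerDl.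
  by rewrite mulr_ge0// exprn_ge0// ltW.
have hk0 : 0 < k + h by rewrite addr_gt0.
have := resolvent_two_steps (euler h m x) (euler k n x) k0 h0.
rewrite -!iterS => /sq-/(_ (normr_ge0 _))/le_trans; apply.
move: (IHm n.+1) IHn; rewrite -/(euler h m.+1 x) -/(euler k n.+1 x).
set a := `|_ - _|; set b := `|_ - _| => ab1 ab2.
set al := k / (k + h); set be := h / (k + h).
have al0 : 0 <= al by rewrite divr_ge0 ?ltW.
have be0 : 0 <= be by rewrite divr_ge0 ?ltW.
have albe : al = 1 - be by rewrite /al /be; field; rewrite gt_eqF.
have H : (al * a + be * b) ^+ 2 <= al * a ^+ 2 + be * b ^+ 2.
  have : 0 <= al * be * (a - b) ^+ 2.
    exact: mulr_ge0 (mulr_ge0 al0 be0) (sqr_ge0 _).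
  suff -> : al * be * (a - b) ^+ 2 = al * a ^+ 2 + be * b ^+ 2 - (al * a + be * b) ^+ 2.
    by rewrite subr_ge0.
  by rewrite albe; ring.
apply: le_trans H _.
apply: le_trans (lerD (ler_wpM2l al0 ab1) (ler_wpM2l be0 ab2)) _.
rewrite le_eqVlt; apply/orP; left; apply/eqP.
rewrite /al /be -!natr1; field.
by rewrite gt_eqF.
Qed.

(** Hitting [s] up to one step covers both the mesh [s / n] of the exponential formula and a mesh
    chosen independently of [s]. *)
Lemma euler_converges x v (s e : R) : A x v -> 0 <= s -> 0 < e ->
  exists2 d : R, 0 < d & forall h k m n, 0 < h <= d -> 0 < k <= d ->
    `|m%:R * h - s| <= h -> `|n%:R * k - s| <= k ->
    `|euler h m x - euler k n x| <= e.
Proof.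
move=> Axv s0 e0.
pose V := `|v| ^+ 2; have V0 : 0 <= V by rewrite exprn_ge0.
(* The bracket is at most [4 d^2 + 2 (s + d) d], hence at most [d (6 + 2 s)] as [d <= 1]. *)
have den : 0 < (V + 1) * (6 + 2 * s) by rewrite mulr_gt0//; lra.
pose d := Num.min 1 (e ^+ 2 / ((V + 1) * (6 + 2 * s))).
have d1 : d <= 1 by rewrite ge_min lexx.
have d0 : 0 < d by rewrite lt_min ltr01 divr_gt0// exprn_gt0.
have dV : d * ((V + 1) * (6 + 2 * s)) <= e ^+ 2.
  by rewrite -ler_pdivlMr// ge_min lexx orbT.
exists d => // h k m n /andP[h0 hd] /andP[k0 kd] hs ks.
rewrite -(@ler_pXn2r R 2) ?nnegrE ?(ltW e0)//.
apply: le_trans (euler_two_meshes m n h0 k0 Axv) _.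
apply: le_trans dV; rewrite -/V.
set mh := m%:R * h in hs *; set nk := n%:R * k in ks *.
have -> : m%:R * h ^+ 2 = mh * h by rewrite /mh; ring.
have -> : n%:R * k ^+ 2 = nk * k by rewrite /nk; ring.
have mh0 : 0 <= mh by rewrite mulr_ge0// ltW.
have nk0 : 0 <= nk by rewrite mulr_ge0// ltW.
move: hs ks; rewrite !ler_distl => /andP[h1 h2] /andP[k1 k2].
apply: (@le_trans _ _ (V * (d * (6 + 2 * s)))); last by nra.
apply: ler_wpM2l => //.
have b1 : (mh - nk) ^+ 2 <= 4 * d ^+ 2.
  have : 0 <= (2 * d - (mh - nk)) * (2 * d + (mh - nk)) by apply: mulr_ge0; lra.
  lra.
have b2 : mh * h <= (s + d) * d by apply: ler_pM => //; [exact: ltW|lra].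
have b3 : nk * k <= (s + d) * d by apply: ler_pM => //; [exact: ltW|lra].
have b4 : d ^+ 2 <= d by rewrite expr2 ler_piMr// ltW.
lra.
Qed.

End implicit_euler.

(** * Convergence of the exponential formula *)

Section exponential_formula.
Context {R : realType} {X : completeNormedModType R}.
Context (A : X -> set X) (X_smooth : uniformly_smooth X) (A_maccr : m_accretive A).

Lemma semigroup_euler x v (s e : R) : A x v -> 0 < s -> 0 < e ->
  exists2 d : R, 0 < d & forall h j, 0 < h <= d -> `|j%:R * h - s| <= h ->
    `|semigroup A s x - euler A h j x| <= e.
Proof.
move=> Axv s0 e0.
pose u (n : nat) := iter n (resolvent A (s / n%:R)) x.
have mesh (d : R) : 0 < d -> exists N, forall n, (N <= n)%N ->
    0 < s / n%:R <= d /\ `|n%:R * (s / n%:R) - s| <= s / n%:R.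
  move=> d0; exists (Num.trunc (s / d)).+1 => n Nn.
  have n0 : 0 < n%:R :> R by rewrite ltr0n (leq_trans _ Nn).
  rewrite divr_gt0//= [n%:R * _]mulrC divfK ?gt_eqF// subrr normr0.
  split; last by rewrite divr_ge0 ?ltW.
  rewrite ler_pdivrMr// mulrC -ler_pdivrMr//.
  by rewrite (le_trans (ltW (truncnS_gt _)))// ler_nat.
(* Convergence comes first, since only then is [lim] in [semigroup] the actual limit. *)
have u_cvg : cvg (u @ \oo).
  apply: cauchy_seq_is_cvg => r r0.
  have [d d0 Hd] := euler_converges X_smooth A_maccr Axv (ltW s0) r0.
  have [N HN] := mesh _ d0; exists N => m n /HN[m1 m2] /HN[n1 n2].
  exact: Hd.
have e2 : 0 < e / 2 by rewrite divr_gt0.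
have [d d0 Hd] := euler_converges X_smooth A_maccr Axv (ltW s0) e2.
exists d => // h j hd hj; have [N HN] := mesh _ d0.
have [M _ HM] := (cvgrPdist_le _ _).1 u_cvg _ e2.
have [n1 n2] := HN _ (leq_maxl N M).
apply: le_trans (ler_distD (u (maxn N M)) _ _) _.
rewrite [leRHS]splitr lerD//; first exact: (HM _ (leq_maxr N M)).
exact: Hd.
Qed.

End exponential_formula.

(** * The bound [chi] *)

Lemma chi_ge (R : realType) b k :
  2^-1 * b%:R ^+ 2 + 1 <= (chi b k)%:R / k.+1%:R :> R.
Proof.
rewrite /chi natrM mulfK ?pnatr_eq0//.
have := ceil_ge (2^-1 * b%:R ^+ 2 + 1 : rat).
set c := Num.ceil _ => H.
have c0 : 0 <= c.
  rewrite -(ler0z rat); apply: le_trans H.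
  by rewrite addr_ge0// mulr_ge0// exprn_ge0.
(* The ceiling is taken over the rationals; the embedding into [R] transfers the inequality. *)
rewrite -(ler_rat R) in H.
rewrite -[X in _ <= X]/((`|c|%N : int)%:~R) gez0_abs//.
by move: H; rewrite rmorphD rmorphM fmorphV rmorphXn /= !ratr_nat ratr_int rmorph1.
Qed.

Lemma leq_chi b k l : (k <= l)%N -> (chi b k <= chi b l)%N.
Proof. by move=> kl; rewrite /chi leq_mul2l ltnS kl orbT. Qed.

(** * Decrease of the distance to the zeros along the iterates *)

Section descent.
Context {R : realType} {X : completeNormedModType R}.
Context (X_convex : uniformly_convex X) (X_smooth : uniformly_smooth X).
Context (A : X -> set X) (A_maccr : m_accretive A) (A_zero : zeros A !=set0).

Local Notation P := (nearest_point (zeros A)).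

Lemma nearest_zeroP x :
  zeros A (P x) /\ forall q, zeros A q -> `|x - P x| <= `|x - q|.
Proof.
have /xgetPex : exists p, [set p | zeros A p /\
    forall q, zeros A q -> `|x - p| <= `|x - q|] p.
  apply: nearest_point_exists => //; first exact: closed_zeros.
  by move=> p q; exact: zeros_midpoint.
exact.
Qed.

(** The midpoint of the zeros nearest to [u + w] and [u - w] is a zero competing with [P u]. *)
Lemma dist_zeros_midconvex u w :
  2 * `|u - P u| <= `|u + w - P (u + w)| + `|u - w - P (u - w)|.
Proof.
have [A1 _] := nearest_zeroP (u + w); have [A2 _] := nearest_zeroP (u - w).
have [_ /(_ _ (zeros_midpoint X_smooth A_maccr X_convex A1 A2))] := nearest_zeroP u.
rewrite -ler_pdivlMl// => /le_trans; apply.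
rewrite -{1}(half_double u) -scalerBr normrZ ger0_norm ?invr_ge0// ler_wpM2l ?invr_ge0//.
rewrite [X in `|X|](_ : _ = (u + w - P (u + w)) + (u - w - P (u - w))) ?ler_normD//.
by rewrite addrACA -opprD (addrACA u) subrr addr0.
Qed.

(* The distance d is midpoint convex and d (u - h y) <= |u - h y - P u|, where the
   right-hand side is controlled by smoothness at u - P u alone: no continuity
   of P or of the duality map is needed. *)
Lemma dist_zeros_tangent (e : R) : 0 < e -> exists2 d : R, 0 < d &
  forall u y (h : R), 0 <= h -> h * `|y| <= d * `|u - P u| ->
    h * duality_map (u - P u) y <=
      (`|u + h *: y - P (u + h *: y)| ^+ 2 - `|u - P u| ^+ 2) / 2
      + e * (h * (`|u - P u| * `|y|)).
Proof.
move=> e0; have [d d0 Hd] := uniformly_smooth_scaled X_smooth e0.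
exists d => // u y h h0 hy.
have := dist_zeros_midconvex u (h *: y).
have := (nearest_zeroP (u - h *: y)).2 _ (nearest_zeroP u).1.
set du := `|u - P u|; set dm := `|u - _ - P (u - _)|;
  set dp := `|u + h *: y - P _|.
set z := u - P u.
rewrite addrAC -/z => dm_le du_le.
have nhy : `|h *: y| = h * `|y| by rewrite normrZ ger0_norm.
have := Hd z (h *: y); rewrite nhy -/z => /(_ hy) smooth_z.
have : du ^+ 2 + h * duality_map z y <= du * `|z + h *: y|.
  apply: le_trans (duality_map_bound z (z + h *: y) X_smooth).
  apply: le_trans (ler_norm _).
  rewrite addrC -(duality_map_self z X_smooth) (addrC z).
  by rewrite (duality_map_linear z X_smooth).
have du0 : 0 <= du by exact: normr_ge0.
(* Smoothness bounds [|z + h y| + |z - h y|], and [dm <= |z - h y|]. *)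
have a1 : du * (`|z + h *: y|) <= du * (2 * du + e * (h * `|y|) - dm).
  by apply: ler_wpM2l => //; rewrite -/du in smooth_z; lra.
have a2 : du * (2 * du - dm) <= du * dp by apply: ler_wpM2l => //; lra.
have a3 : 0 <= (dp - du) ^+ 2 by exact: sqr_ge0.
rewrite -/z -/du; lra.
Qed.

Lemma euler_dist_zeros h n x : 0 < h ->
  `|euler A h n x - P (euler A h n x)| <= `|x - P x|.
Proof.
move=> h0; have [Px _] := nearest_zeroP x.
have [_ /(_ _ Px)/le_trans] := nearest_zeroP (euler A h n x); apply.
exact: (euler_dist_zero X_smooth A_maccr x h0 Px (leq0n n)).
Qed.

Lemma euler_small_slope x v (B K T c : R) : A x v -> `|x - P x| <= B ->
  `|v| <= K -> 0 < c -> 2^-1 * B ^+ 2 + 1 <= T * c ->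
  exists2 d : R, 0 < d & forall N, (0 < N)%N -> T / N%:R <= d ->
    exists2 i, (i < N)%N &
      let u := euler A (T / N%:R) i.+1 x in
      duality_map (u - P u) (euler_slope A (T / N%:R) i x) <= c.
Proof.
move=> Axv xB vK c0 Tc.
have B0 : 0 <= B by exact: le_trans xB.
have K0 : 0 <= K by exact: le_trans vK.
have T0 : 0 < T.
  rewrite -(pmulr_lgt0 _ c0); apply: lt_le_trans Tc.
  by rewrite ltr_wpDl// mulr_ge0// exprn_ge0.
pose D := 2 * (T * (B * K) + 1).
have D0 : 0 < D by rewrite mulr_gt0// ltr_wpDl// !mulr_ge0// ltW.
have [d d0 Hd] := dist_zeros_tangent (ltac:(by rewrite invr_gt0) : 0 < D^-1).
exists (d * c / (K + 1) ^+ 2).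
  by rewrite divr_gt0 ?mulr_gt0 ?exprn_gt0// ltr_wpDl.
move=> N N0; set h := T / N%:R => hd.
have h0 : 0 < h by rewrite divr_gt0// ltr0n.
have hN : N%:R * h = T by rewrite mulrC divfK// pnatr_eq0 -lt0n.
apply: contrapT => contra.
have big i : (i < N)%N -> c < duality_map (euler A h i.+1 x - P (euler A h i.+1 x))
    (euler_slope A h i x).
  by move=> iN; rewrite ltNge; apply/negP => le_c; apply: contra; exists i.
pose dist n := `|euler A h n x - P (euler A h n x)|.
have dist_decr n : (n < N)%N ->
    h * c <= (dist n ^+ 2 - dist n.+1 ^+ 2) / 2 + D^-1 * (h * (B * K)).
  move=> nN; have c_lt := big n nN; set u := euler A h n.+1 x in c_lt.
  set y := euler_slope A h n x in c_lt.
  have yK : `|y| <= K.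
    by apply: le_trans vK; exact: (euler_slope_norm X_smooth A_maccr n h0 Axv).
  have uB : `|u - P u| <= B by apply: le_trans xB; exact: euler_dist_zeros.
  have uy : u + h *: y = euler A h n x.
    by rewrite /y /euler_slope scalerA divff ?gt_eqF// scale1r addrC subrK.
  have cK : c <= `|u - P u| * K.
    apply: le_trans (ltW c_lt) _; apply: le_trans (ler_norm _) _.
    by apply: le_trans (duality_map_bound _ _ X_smooth) _; rewrite ler_wpM2l.
  have hy : h * `|y| <= d * `|u - P u|.
    have KK : 0 < (K + 1) ^+ 2 by rewrite exprn_gt0// ltr_wpDl.
    have Kgt : 0 < K.
      rewrite lt_neqAle K0 andbT; apply/eqP => K00; move: cK.
      by rewrite -K00 mulr0 leNgt c0.
    apply: (@le_trans _ _ (h * K)); first by rewrite ler_wpM2l// ltW.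
    rewrite -(ler_pM2r Kgt) -mulrA.
    apply: (@le_trans _ _ (d * c)); last by rewrite -mulrA ler_wpM2l// ltW.
    move: hd; rewrite ler_pdivlMr// => /(le_trans _); apply.
    by rewrite ler_wpM2l ?ltW//; lra.
  have := Hd u y h (ltW h0) hy; rewrite uy -/(dist n) -/(dist n.+1).
  have : h * c <= h * duality_map (u - P u) y by rewrite ler_wpM2l// ltW.
  move=> /le_trans H /H /le_trans; apply; rewrite lerD2l.
  apply: ler_wpM2l; first by rewrite invr_ge0 ltW.
  by apply: ler_wpM2l; [exact: ltW|apply: ler_pM; rewrite ?normr_ge0].
have sum n : (n <= N)%N -> n%:R * (h * c) <=
    (dist 0%N ^+ 2 - dist n ^+ 2) / 2 + n%:R * (D^-1 * (h * (B * K))).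
  elim: n => [_|n IHn nN]; first by rewrite !mul0r subrr mul0r addr0.
  by have := IHn (ltnW nN); have := dist_decr n nN; rewrite -natr1; lra.
have := sum N (leqnn N).
have -> : N%:R * (h * c) = T * c by rewrite mulrA hN.
have -> : N%:R * (D^-1 * (h * (B * K))) = T * (B * K) / D by rewrite -hN; ring.
have : T * (B * K) / D <= 2^-1.
  by rewrite ler_pdivrMr// /D; lra.
have : dist 0%N ^+ 2 <= B ^+ 2 by rewrite lerXn2r// nnegrE normr_ge0.
have : 0 <= dist N ^+ 2 by exact: sqr_ge0.
lra.
Qed.

End descent.

Theorem theorem4p3 (R : realType) (X : completeNormedModType R)
  (X_convex : uniformly_convex X) (X_smooth : uniformly_smooth X)
  (A : X -> set X) (A_maccr : m_accretive A) (A_zero : zeros A !=set0)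
  (p : X) (p_zero : zeros A p)
  (Omega : nat -> (nat -> nat) -> (nat -> nat)) (A_mod : weak_modulus A Omega)
  (x v : X) (x_dom : dom A x) (Axv : A x v)
  (b K : nat) (b_ge : `|x - nearest_point (zeros A) x| <= b%:R)
  (K_ge : Num.max `|v| (`|x - p| + `|p|) <= K%:R) :
  forall (k : nat) (s s' : R),
    (chi b (Omega K id (2 * k + 1)%N))%:R <= s ->
    (chi b (Omega K id (2 * k + 1)%N))%:R <= s' ->
    `|semigroup A s x - semigroup A s' x| <= k.+1%:R^-1.
Proof.
move=> k s s'; set M := Omega K id _ => Ms Ms'.
move: K_ge; rewrite ge_max => /andP[vK pK].
have chi_c n : 2^-1 * b%:R ^+ 2 + 1 <= (chi b n)%:R * n.+1%:R^-1 :> R.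
  exact: chi_ge.
have chi0 n : 0 < (chi b n)%:R :> R.
  rewrite -(pmulr_lgt0 _ (ltac:(by rewrite invr_gt0) : 0 < n.+1%:R^-1)).
  by apply: lt_le_trans (chi_c n); rewrite ltr_wpDl// mulr_ge0// exprn_ge0.
have s0 : 0 < s by apply: lt_le_trans Ms.
have s'0 : 0 < s' by apply: lt_le_trans Ms'.
suff H (e : R) : 0 < e -> `|semigroup A s x - semigroup A s' x| <= k.+1%:R^-1 + e.
  by apply/ler_addgt0Pr => e; exact: H.
move=> e0; have e2 : 0 < e / 2 by rewrite divr_gt0.
have [d d0 Hd] := semigroup_euler X_smooth A_maccr Axv s0 e2.
have [d' d'0 Hd'] := semigroup_euler X_smooth A_maccr Axv s'0 e2.
pose P := nearest_point (zeros A).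
have /choice[xy xyP] (n : nat) : exists z : X * X,
    [/\ A z.1 z.2, `|z.1| <= K%:R, `|z.2| <= K%:R,
        `|duality_map (z.1 - P z.1) z.2| <= n.+1%:R^-1 &
        exists h i, [/\ 0 < h, h <= d, h <= d', i%:R * h <= (chi b n)%:R &
          z.1 = euler A h i x]].
  have c0 : 0 < n.+1%:R^-1 :> R by rewrite invr_gt0.
  have [r r0 Hr] :=
    euler_small_slope X_convex X_smooth A_maccr A_zero Axv b_ge vK c0 (chi_c n).
  pose m := Num.min r (Num.min d d').
  have m0 : 0 < m by rewrite !lt_min r0 d0 d'0.
  have [mr [md md']] : m <= r /\ m <= d /\ m <= d'.
    by rewrite !ge_min !lexx !orbT.
  pose N := (Num.trunc ((chi b n)%:R / m)).+1; pose h : R := (chi b n)%:R / N%:R.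
  have hm : h <= m.
    by rewrite ler_pdivrMr// mulrC -ler_pdivrMr// ltW// truncnS_gt.
  have h0 : 0 < h by rewrite divr_gt0.
  have [i iN Hi] := Hr N isT (le_trans hm mr).
  have Ay := euler_slopeP A_maccr i x h0.
  exists (euler A h i.+1 x, euler_slope A h i x) => /=; split=> //.
  - apply: le_trans pK; rewrite -[X in `|X|](subrK p).
    apply: le_trans (ler_normD _ _) _; rewrite lerD2r.
    exact: (euler_dist_zero X_smooth A_maccr x h0 p_zero (leq0n i.+1)).
  - by apply: le_trans vK; exact: (euler_slope_norm X_smooth A_maccr i h0 Axv).
  - rewrite ger0_norm//.
    have [Pu _] := nearest_zeroP X_convex X_smooth A_maccr A_zero (euler A h i.+1 x).
    by have := A_maccr.1 _ _ _ _ Ay Pu; rewrite subr0.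
  - exists h, i.+1; split => //; [exact: le_trans md|exact: le_trans md'|].
    rewrite -[leRHS](@divfK _ N%:R) ?pnatr_eq0// -/h [leRHS]mulrC.
    by apply: ler_wpM2r; [exact: ltW|rewrite ler_nat].
have xy_mod : rate_of_approximate_zeros
    (fun n => `|(xy n).1 - P (xy n).1|) (Omega K id).
  apply: (A_mod (fun n => (xy n).1) (fun n => (xy n).2)).
    by move=> n; have [] := xyP n.
  move=> i n /= ni; have [_ _ _ + _] := xyP n; move/le_trans; apply.
  by rewrite lef_pV2 ?posrE// ler_nat.
have [n nM xn_close] := xy_mod (2 * k + 1)%N.
have [_ _ _ _ [h [i [h0 hd hd' ih xnE]]]] := xyP n.
have [Pxn _] := nearest_zeroP X_convex X_smooth A_maccr A_zero (xy n).1.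
have chi_n : (chi b n)%:R <= (chi b M)%:R :> R by rewrite ler_nat leq_chi.
have near_zero (t : R) : (chi b M)%:R <= t -> exists j,
    `|j%:R * h - t| <= h /\ `|euler A h j x - P (xy n).1| <= (2 * k.+1%:R)^-1.
  move=> Mt; have th0 : 0 <= t / h.
    by rewrite divr_ge0 ?(ltW h0)// (le_trans _ Mt).
  have /andP[t1 t2] := truncn_itv th0.
  rewrite ler_pdivlMr// in t1; rewrite ltr_pdivrMr// -natr1 mulrDl mul1r in t2.
  exists (Num.trunc (t / h)); split.
    by rewrite ler_distl lerBlDr (ltW t2) (le_trans t1)// lerDl ltW.
  have -> : 2 * k.+1%:R = (2 * k + 1).+1%:R :> R.
    by rewrite -natrM mulnS addn1 add2n.
  apply: le_trans xn_close; rewrite xnE in Pxn *.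
  apply: euler_dist_zero => //.
  rewrite truncn_ge_nat// ler_pdivlMr//.
  by rewrite (le_trans ih)// (le_trans chi_n).
have [j [js jP]] := near_zero s Ms; have [j' [js' jP']] := near_zero s' Ms'.
have Sj := Hd h j (ltac:(by rewrite h0) : 0 < h <= d) js.
have Sj' := Hd' h j' (ltac:(by rewrite h0) : 0 < h <= d') js'.
have t1 := ler_distD (P (xy n).1) (semigroup A s x) (semigroup A s' x).
have t2 := ler_distD (euler A h j x) (semigroup A s x) (P (xy n).1).
have t3 := ler_distD (euler A h j' x) (semigroup A s' x) (P (xy n).1).
rewrite (distrC (P _) (semigroup A s' x)) in t1.
have half : (2 * k.+1%:R)^-1 + (2 * k.+1%:R)^-1 = k.+1%:R^-1 :> R.
  by rewrite invfM ![2^-1 * _]mulrC -splitr.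
have SP := le_trans t2 (lerD Sj jP); have S'P := le_trans t3 (lerD Sj' jP').
apply: le_trans t1 (le_trans (lerD SP S'P) _).
by rewrite addrACA -splitr half addrC.
Qed.
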